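(* Let $m\in\{1,2\}$ and $q=m+1$. Let $a,b$ be real-valued functions of $x\in[0,\infty)$, and for each $x$ let $(U(t,x),V(t,x))$, $t\ge0$, solve the CLM-$q$ problem with $V(0,x)=a(x)$, $U(0,x)=b(x)$, as described in the context. Then the solution blows up in finite time if and only if the set $$Z:=\{x:\ b(x)=0\ \text{and}\ a(x)>0\}$$ is nonempty. Moreover, if $\bar x\in Z$ satisfies $a(\bar x)=\max_{x\in Z}a(x)=:M$, then $U(t,\bar x)\equiv0$ and $V(t,\bar x)\to+\infty$ as $t\uparrow T=\frac{2(q+1)}{M}$.
   Context: The CLM-$q$ problem is, for each fixed $x$ (a parameter), the ODE $$V_{tt}=VV_t-\tfrac{q}{2(q+1)^2}V^3,\qquad V(0)=a(x),\qquad V_t(0)=\tfrac{1}{2(q+1)}\bigl(a(x)^2-b(x)^2\bigr).$$ It is the equation obtained by eliminating $U$ from the first-order system $$U_t=\tfrac{q}{2(q+1)}UV,\qquad V_t=\tfrac{1}{2(q+1)}(V^2-U^2),\qquad U(0,x)=b(x),\ V(0,x)=a(x),$$ which defines $U$. Blow-up is understood pointwise in $x$: the solution blows up in finite time if for some $x$ the solution of the ODE at that $x$ becomes unbounded at a finite time $t>0$. *)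

(* Defs.v *)
From Stdlib Require Import Reals.
From Coquelicot Require Import Coquelicot.
Open Scope R_scope.

(* [is_derive] with [locally t] restricted to [0, +oo): the right derivative
   at t = 0 and the ordinary derivative at t > 0. *)
Definition is_derive_nonneg (f : R -> R) (t l : R) : Prop :=
  filterdiff f (within (Rle 0) (locally t)) (fun h => scal h l).

Definition lifespan (T : Rbar) (t : R) : Prop := 0 <= t /\ Rbar_lt t T.

Definition CLM_problem (q a0 b0 : R) (T : Rbar) (V : R -> R) : Prop :=
  Rbar_lt 0 T /\
  exists Vt : R -> R,
    (forall t, lifespan T t ->
       is_derive_nonneg V t (Vt t) /\
       is_derive_nonneg Vt t (V t * Vt t - q / (2 * (q + 1) ^ 2) * V t ^ 3)) /\
    V 0 = a0 /\
    Vt 0 = 1 / (2 * (q + 1)) * (a0 ^ 2 - b0 ^ 2).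

Definition CLM_system (q a0 b0 : R) (T : Rbar) (U V : R -> R) : Prop :=
  (forall t, lifespan T t ->
     is_derive_nonneg U t (q / (2 * (q + 1)) * U t * V t) /\
     is_derive_nonneg V t (1 / (2 * (q + 1)) * (V t ^ 2 - U t ^ 2))) /\
  U 0 = b0 /\ V 0 = a0.

Definition CLM_maximal (q a0 b0 : R) (T : Rbar) (V : R -> R) : Prop :=
  CLM_problem q a0 b0 T V /\
  forall (T' : Rbar) (V' : R -> R),
    CLM_problem q a0 b0 T' V' -> Rbar_le T T' ->
    (forall t, lifespan T t -> V' t = V t) -> T' = T.

(* V is a non-extendable solution of the second-order problem on [0, T) and U
   is its companion in the first-order system; values outside [0, T) are
   irrelevant. *)
Definition CLM_solution (q a0 b0 : R) (T : Rbar) (U V : R -> R) : Prop :=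
  CLM_maximal q a0 b0 T V /\ CLM_system q a0 b0 T U V.

Definition blows_up_in_finite_time (T : R -> Rbar) (V : R -> R -> R) : Prop :=
  exists x, 0 <= x /\
  exists t0 : R, 0 < t0 /\ Rbar_le t0 (T x) /\
    forall K : R, exists t, 0 <= t < t0 /\ K < Rabs (V t x).

Definition Zset (a b : R -> R) (x : R) : Prop := 0 <= x /\ b x = 0 /\ 0 < a x.

(* Main.v *)
(* Eliminating time from the first-order system gives a first integral: with
   E = V^2 + U^2/m (m = q - 1) both E^q and U^2 solve the linear equation
   y' = (q/(q+1)) V y, so E^q b^2 = U^2 E(0)^q.  If b <> 0, the inequality
   U^2 <= m E turns this into a bound on E^(q-1), hence on V.  If b = 0 then
   U = 0 and V solves the Riccati equation V' = V^2/(2(q+1)), that is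
   V (1 - a t/(2(q+1))) = a, which is unbounded on a finite interval exactly
   when a > 0.  Maximality identifies T with the pole of this explicit
   solution. *)
Require Import Defs.
From Stdlib Require Import Reals Lra Lia.
From Coquelicot Require Import Coquelicot.
Open Scope R_scope.

(** * One-sided derivatives on the half-line, and uniqueness for linear equations *)

Lemma is_derive_nonneg_pos (f : R -> R) (t l : R) :
  0 < t -> is_derive_nonneg f t l -> is_derive f t l.
Proof.
  intros Ht [Hlin Hdom]; split; [exact Hlin|].
  intros x Hx eps.
  apply (is_filter_lim_locally_unique (V := R_NormedModule)) in Hx; subst x.
  assert (Hlim : is_filter_lim (within (Rle 0) (locally t)) t).
  { intros P HP; unfold within; revert HP; apply filter_imp; tauto. }
  specialize (Hdom t Hlim eps); unfold within in Hdom.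
  assert (Hpos : locally t (fun y => 0 <= y)).
  { apply (filter_imp (fun y => 0 < y)); [intros; lra|].
    apply (open_gt 0 t Ht). }
  generalize (filter_and _ _ Hpos Hdom); apply filter_imp; intuition.
Qed.

Lemma is_derive_is_derive_nonneg (f : R -> R) (t l : R) :
  is_derive f t l -> 0 <= t -> is_derive_nonneg f t l.
Proof.
  intros [Hlin Hdom] Ht; split; [exact Hlin|].
  intros x Hx eps.
  (* The restricted filter has no limit point other than [t]: since [0 <= t], every set in it
     contains [t], and the ball around [x] of radius [Rabs (t - x) / 2] does not. *)
  assert (x = t); [|subst x].
  { destruct (Req_dec x t) as [E|E]; [exact E|exfalso].
    assert (Hd : 0 < Rabs (t - x) / 2).
    { apply Rdiv_lt_0_compat; [apply Rabs_pos_lt; lra|lra]. }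
    destruct (Hx _ (locally_ball x (mkposreal _ Hd))) as [e He].
    specialize (He t (ball_center t e) Ht).
    revert He; unfold ball; simpl; unfold AbsRing_ball, abs, minus, plus, opp; simpl.
    fold (t - x); generalize (Rabs_pos (t - x)); lra. }
  unfold within; generalize (Hdom t (fun P HP => HP) eps).
  apply filter_imp; auto.
Qed.

(** Precomposing with [Rmax 0] extends [f] by the constant [f 0] to the left, so one-sided
    continuity at 0 becomes the two-sided continuity that the mean value and extreme value theorems
    ask for. *)
Lemma is_derive_nonneg_continuity_Rmax (f : R -> R) (t l : R) :
  0 <= t -> is_derive_nonneg f t l -> continuity_pt (fun s => f (Rmax 0 s)) t.
Proof.
  intros Ht Hf; apply continuity_pt_filterlim.
  assert (Hlim : is_filter_lim (within (Rle 0) (locally t)) t).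
  { intros P HP; unfold within; revert HP; apply filter_imp; tauto. }
  rewrite (Rmax_right 0 t Ht).
  apply (filterlim_comp _ _ _ (Rmax 0) f _ (within (Rle 0) (locally t))).
  - intros P [d Hd]; exists d; intros y Hy.
    apply Hd; [|apply Rmax_l].
    revert Hy; unfold ball; simpl; unfold AbsRing_ball, abs, minus, plus, opp; simpl.
    unfold Rmax; destruct (Rle_dec 0 y); [tauto|].
    unfold Rabs; repeat destruct Rcase_abs; lra.
  - apply (fun H => filterdiff_continuous_aux f H t Hlim).
    eexists; exact Hf.
Qed.

Lemma is_derive_Rmax (f : R -> R) (t l : R) :
  0 < t -> is_derive f t l -> is_derive (fun s => f (Rmax 0 s)) t l.
Proof.
  intros Ht; apply is_derive_ext_loc.
  apply (filter_imp (fun y => 0 < y)).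
  - intros y Hy; rewrite Rmax_right; lra.
  - apply (open_gt 0 t Ht).
Qed.

(* Gronwall: if |v| <= K then y^2 exp(-2|k|K s) is nonincreasing. *)
Lemma linear_ode_zero (k : R) (v y : R -> R) (t : R) :
  0 <= t ->
  (forall s, 0 <= s <= t -> continuity_pt v s) ->
  (forall s, 0 <= s <= t -> continuity_pt y s) ->
  (forall s, 0 < s < t -> is_derive y s (k * v s * y s)) ->
  y 0 = 0 -> y t = 0.
Proof.
  intros Ht Cv Cy Dy y0.
  destruct (continuity_ab_maj (fun s => Rabs (v s)) 0 t Ht) as [sM [HM _]].
  { intros s Hs; apply (continuity_pt_comp v Rabs); [now apply Cv|].
    apply Rcontinuity_abs. }
  set (K := Rabs (v sM)) in HM.
  set (c := 2 * Rabs k * K).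
  destruct (MVT_gen (fun s => y s * y s * exp (- c * s)) 0 t
    (fun s => (2 * k * v s - c) * (y s * y s) * exp (- c * s))) as [s [Hs E]].
  - rewrite Rmin_left, Rmax_right by lra; intros s Hs.
    generalize (Dy s Hs); intros D.
    auto_derive; [repeat split; eexists; exact D|].
    replace (Derive (fun x => y x) s) with (k * v s * y s)
      by (symmetry; now apply is_derive_unique).
    ring.
  - rewrite Rmin_left, Rmax_right by lra; intros s Hs.
    apply continuity_pt_mult; [apply continuity_pt_mult; now apply Cy|].
    apply derivable_continuous_pt; reg.
  - rewrite Rmin_left, Rmax_right in Hs by lra.
    rewrite y0 in E.
    assert (Hc : 2 * k * v s - c <= 0).
    { specialize (HM s Hs); simpl in HM.
      generalize (Rle_abs (k * v s)); rewrite Rabs_mult.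
      generalize (Rabs_pos k); unfold c; nra. }
    assert (H1 : 0 < exp (- c * s)) by apply exp_pos.
    assert (H2 : 0 < exp (- c * t)) by apply exp_pos.
    assert (H3 : 0 <= y s * y s * exp (- c * s) * t).
    { apply Rmult_le_pos; [|lra]; apply Rmult_le_pos; nra. }
    assert (y t * y t * exp (- c * t) <= 0) by nra.
    assert (y t * y t <= 0) by nra.
    nra.
Qed.

(** * First integral of the system and the a priori bound *)

Lemma CLM_system_Rmax (q a0 b0 : R) (T : Rbar) (U V : R -> R) (t : R) :
  CLM_system q a0 b0 T U V -> lifespan T t ->
  let u := fun s => U (Rmax 0 s) in
  let v := fun s => V (Rmax 0 s) in
  (forall s, 0 <= s <= t -> continuity_pt u s) /\
  (forall s, 0 <= s <= t -> continuity_pt v s) /\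
  (forall s, 0 < s < t -> is_derive u s (q / (2 * (q + 1)) * u s * v s)) /\
  (forall s, 0 < s < t ->
     is_derive v s (1 / (2 * (q + 1)) * (v s ^ 2 - u s ^ 2))).
Proof.
  intros [HS _] [Ht HT] u v.
  assert (L : forall s, 0 <= s <= t -> lifespan T s).
  { intros s Hst; split; [lra|].
    apply (Rbar_le_lt_trans s t T); [simpl; lra|exact HT]. }
  split; [|split; [|split]]; intros s Hst;
    (destruct (HS s) as [DU DV]; [apply L; lra|]).
  - apply (is_derive_nonneg_continuity_Rmax U s _ (proj1 Hst) DU).
  - apply (is_derive_nonneg_continuity_Rmax V s _ (proj1 Hst) DV).
  - unfold u, v; apply is_derive_Rmax; [lra|]; rewrite Rmax_right by lra.
    apply is_derive_nonneg_pos; [lra|exact DU].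
  - unfold u, v; apply is_derive_Rmax; [lra|]; rewrite Rmax_right by lra.
    apply is_derive_nonneg_pos; [lra|exact DV].
Qed.

(** Since q - m = 1, the U^2 terms combine to give E' = V E/(q+1), while (U^2)' = (q/(q+1)) V U^2.
    The difference [y] of the two sides therefore solves a linear equation and vanishes at 0. The
    cross-multiplied form avoids dividing by [b0]. *)
Lemma CLM_system_first_integral (m : nat) (a0 b0 : R) (T : Rbar)
  (U V : R -> R) (t : R) :
  (1 <= m)%nat ->
  CLM_system (INR m + 1) a0 b0 T U V -> lifespan T t ->
  (V t ^ 2 + U t ^ 2 / INR m) ^ S m * b0 ^ 2 =
  U t ^ 2 * (a0 ^ 2 + b0 ^ 2 / INR m) ^ S m.
Proof.
  intros Hm HS Ht.
  assert (Hm1 : 1 <= INR m) by (apply (le_INR 1); exact Hm).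
  destruct (CLM_system_Rmax _ _ _ _ _ _ _ HS Ht) as [Cu [Cv [Du Dv]]].
  destruct HS as [_ [U0 V0]]; destruct Ht as [Ht _].
  set (u := fun s => U (Rmax 0 s)) in *; set (v := fun s => V (Rmax 0 s)) in *.
  set (E0 := (a0 ^ 2 + b0 ^ 2 / INR m) ^ S m).
  set (y := fun s => (v s ^ 2 + u s ^ 2 / INR m) ^ S m * b0 ^ 2 - u s ^ 2 * E0).
  assert (ut : u t = U t) by (unfold u; now rewrite Rmax_right).
  assert (vt : v t = V t) by (unfold v; now rewrite Rmax_right).
  assert (u0 : u 0 = b0) by (unfold u; rewrite Rmax_right; [exact U0|lra]).
  assert (v0 : v 0 = a0) by (unfold v; rewrite Rmax_right; [exact V0|lra]).
  enough (Hy : y t = 0).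
  { unfold y in Hy; rewrite ut, vt in Hy; lra. }
  apply (linear_ode_zero ((INR m + 1) / (INR m + 2)) v y t Ht Cv).
  - intros s Hs; unfold y.
    assert (Cp : forall f n, continuity_pt f s -> continuity_pt (fun x => f x ^ n) s).
    { intros f n Cf; apply (continuity_pt_comp f (fun x => x ^ n)); [exact Cf|].
      apply derivable_continuous_pt, derivable_pt_pow. }
    assert (Cc : forall c, continuity_pt (fun _ => c) s).
    { intros c; apply continuity_pt_const; intros ? ?; reflexivity. }
    apply (continuity_pt_minus (fun s => _ ^ S m * _) (fun s => _ * E0)).
    + apply (continuity_pt_mult (fun s => _ ^ S m) (fun _ => _)); [|apply Cc].
      apply Cp, (continuity_pt_plus (fun s => v s ^ 2) (fun s => u s ^ 2 / _)).
      * apply Cp; auto.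
      * apply (continuity_pt_mult (fun s => u s ^ 2) (fun _ => / INR m));
          [apply Cp; auto|apply Cc].
    + apply (continuity_pt_mult (fun s => _ ^ 2) (fun _ => _)); [|apply Cc].
      apply Cp; auto.
  - intros s Hs; unfold y.
    assert (D1 : is_derive u s
      ((INR m + 1) / (2 * (INR m + 1 + 1)) * u s * v s)) by exact (Du s Hs).
    assert (D2 : is_derive v s
      (1 / (2 * (INR m + 1 + 1)) * (v s ^ 2 - u s ^ 2))) by exact (Dv s Hs).
    (* Forgetting the [Rmax] bodies makes [auto_derive] treat [u] and [v] as abstract functions. *)
    clearbody u v E0.
    auto_derive; [repeat split; eexists; eassumption|].
    replace (Derive (fun x => u x) s) with
      ((INR m + 1) / (2 * (INR m + 1 + 1)) * u s * v s)
      by (symmetry; now apply is_derive_unique).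
    replace (Derive (fun x => v x) s) with
      (1 / (2 * (INR m + 1 + 1)) * (v s ^ 2 - u s ^ 2))
      by (symmetry; now apply is_derive_unique).
    change (match m with O => 1 | S _ => INR m + 1 end) with (INR (S m)).
    rewrite S_INR; simpl pow.
    replace (u s * (u s * 1) * / INR m) with (u s * (u s * 1) / INR m)
      by reflexivity.
    (* The power E^m comes both from differentiating E^(m+1) and from E^(m+1) = E E^m; as a single
       atom [P] it enters the identity linearly. *)
    set (P := (_ + _) ^ m).
    field; lra.
  - unfold y; rewrite u0, v0; fold E0; ring.
Qed.

(** Inserting U^2 <= m E into the first integral gives E^(m+1) b^2 <= m E E0; cancelling E leaves a
    bound on E^m that does not depend on time. *)
Lemma CLM_system_bounded (m : nat) (a0 b0 : R) (T : Rbar) (U V : R -> R) :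
  (1 <= m)%nat -> b0 <> 0 ->
  CLM_system (INR m + 1) a0 b0 T U V ->
  exists K, forall t, lifespan T t -> Rabs (V t) <= K.
Proof.
  intros Hm Hb HS.
  assert (Hm1 : 1 <= INR m) by (apply (le_INR 1); exact Hm).
  set (E0 := (a0 ^ 2 + b0 ^ 2 / INR m) ^ S m).
  assert (Hb2 : 0 < b0 ^ 2) by nra.
  assert (Hdiv : forall z, 0 <= z -> 0 <= z / INR m).
  { intros z Hz; apply Rmult_le_pos; [exact Hz|].
    apply Rlt_le, Rinv_0_lt_compat; lra. }
  assert (HE0 : 0 <= E0).
  { apply pow_le; generalize (pow2_ge_0 a0) (Hdiv _ (pow2_ge_0 b0)); lra. }
  assert (HC : 0 <= INR m * E0 / b0 ^ 2).
  { apply Rmult_le_pos; [nra|]; apply Rlt_le, Rinv_0_lt_compat, Hb2. }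
  (* One unit covers the case E <= 1, the other comes from |V| <= 1 + V^2. *)
  exists (2 + INR m * E0 / b0 ^ 2); intros t Ht.
  generalize (CLM_system_first_integral m a0 b0 T U V t Hm HS Ht); fold E0.
  set (E := V t ^ 2 + U t ^ 2 / INR m); intros HI.
  assert (HV : V t ^ 2 <= E).
  { unfold E; generalize (Hdiv _ (pow2_ge_0 (U t))); lra. }
  assert (HU : U t ^ 2 <= INR m * E).
  { replace (U t ^ 2) with (INR m * (U t ^ 2 / INR m)) by (field; lra).
    apply Rmult_le_compat_l; [lra|].
    unfold E; generalize (pow2_ge_0 (V t)); lra. }
  assert (HE : E <= 1 + INR m * E0 / b0 ^ 2).
  (* Splitting at 1 replaces the m-th root: for E > 1, E <= E^m. *)
  { destruct (Rle_dec E 1) as [H1|H1]; [lra|].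
    assert (HEm : E <= E ^ m).
    { rewrite <- (pow_1 E) at 1; apply Rle_pow; [lra|exact Hm]. }
    assert (HEm2 : E ^ m * b0 ^ 2 <= INR m * E0).
    { apply (Rmult_le_reg_l E); [lra|].
      rewrite <- Rmult_assoc, (tech_pow_Rmult E m), HI.
      replace (E * (INR m * E0)) with (INR m * E * E0) by ring.
      apply Rmult_le_compat_r; assumption. }
    assert (E ^ m <= INR m * E0 / b0 ^ 2); [|lra].
    apply (Rmult_le_reg_r (b0 ^ 2)); [exact Hb2|].
    replace (INR m * E0 / b0 ^ 2 * b0 ^ 2) with (INR m * E0) by (field; lra).
    exact HEm2. }
  assert (Rabs (V t) <= 1 + V t ^ 2); [|lra].
  unfold Rabs; destruct Rcase_abs; nra.
Qed.

(** * The case b = 0: explicit Riccati solution and its pole *)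

Lemma CLM_system_zero (q a0 : R) (T : Rbar) (U V : R -> R) (t : R) :
  CLM_system q a0 0 T U V -> lifespan T t ->
  U t = 0 /\ V t * (1 - a0 * t / (2 * (q + 1))) = a0.
Proof.
  intros HS Ht.
  assert (HU : forall s, lifespan T s -> U s = 0).
  { intros s Hs.
    destruct (CLM_system_Rmax _ _ _ _ _ _ _ HS Hs) as [Cu [Cv [Du _]]].
    destruct HS as [_ [U0 _]]; destruct Hs as [Hs _].
    generalize (linear_ode_zero (q / (2 * (q + 1))) _ _ s Hs Cv Cu); simpl.
    rewrite !(Rmax_right 0 0), (Rmax_right 0 s) by lra.
    intros H; apply H; [|exact U0].
    intros r Hr; specialize (Du r Hr).
    now replace (q / (2 * (q + 1)) * V (Rmax 0 r) * U (Rmax 0 r))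
      with (q / (2 * (q + 1)) * U (Rmax 0 r) * V (Rmax 0 r)) by ring. }
  split; [now apply HU|].
  destruct (CLM_system_Rmax _ _ _ _ _ _ _ HS Ht) as [_ [Cv [_ Dv]]].
  destruct HS as [_ [_ V0]]; destruct Ht as [Ht HT].
  set (v := fun s => V (Rmax 0 s)) in *.
  set (k := / (2 * (q + 1))).
  assert (vt : v t = V t) by (unfold v; now rewrite Rmax_right).
  assert (v0 : v 0 = a0) by (unfold v; rewrite Rmax_right; [exact V0|lra]).
  enough (Hy : v t * (1 - a0 * t * k) - a0 = 0).
  { rewrite vt in Hy; unfold Rdiv; fold k; lra. }
  (* From v' = k v^2 the defect y = v (1 - a k s) - a satisfies y' = k v y, so uniqueness applies
     without dividing by a factor that may vanish. *)
  apply (linear_ode_zero k v (fun s => v s * (1 - a0 * s * k) - a0) t Ht Cv).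
  - intros s Hs.
    apply (continuity_pt_minus (fun s => _ * _) (fun _ => a0)).
    + apply (continuity_pt_mult v (fun s => 1 - a0 * s * k)); [now apply Cv|].
      apply derivable_continuous_pt; reg.
    + apply continuity_pt_const; intros ? ?; reflexivity.
  - intros s Hs; generalize (Dv s Hs); intros D.
    rewrite (HU (Rmax 0 s)) in D.
    2:{ rewrite Rmax_right by lra; split; [lra|].
        apply (Rbar_le_lt_trans s t T); [simpl; lra|exact HT]. }
    fold (v s) in D.
    clearbody v.
    auto_derive; [repeat split; eexists; exact D|].
    replace (Derive (fun x => v x) s) with
      (1 / (2 * (q + 1)) * (v s ^ 2 - 0 ^ 2))
      by (symmetry; now apply is_derive_unique).
    unfold Rdiv; fold k; ring.
  - rewrite v0; ring.
Qed.

(** This is the competitor to be fed to maximality, hence a solution of the second-order problem.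
    With k = 1/(2(q+1)) and V' = k V^2, both V'' and the right-hand side equal 2 k^2 V^3. *)
Lemma CLM_problem_riccati (q a0 : R) :
  0 < q + 1 -> 0 < a0 ->
  CLM_problem q a0 0 (2 * (q + 1) / a0)
    (fun t => a0 / (1 - a0 * t / (2 * (q + 1)))).
Proof.
  intros Hq Ha.
  assert (Hp : 0 < 2 * (q + 1) / a0).
  { apply Rdiv_lt_0_compat; lra. }
  split; [exact Hp|].
  exists (fun t => / (2 * (q + 1)) * (a0 / (1 - a0 * t / (2 * (q + 1)))) ^ 2).
  split; [|split; field; lra].
  intros t [Ht0 Ht]; simpl in Ht.
  assert (Hd : 0 < 1 - a0 * t / (2 * (q + 1))).
  { apply (Rmult_lt_reg_r (2 * (q + 1) / a0)); [exact Hp|].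
    replace ((1 - a0 * t / (2 * (q + 1))) * (2 * (q + 1) / a0))
      with (2 * (q + 1) / a0 - t) by (field; lra).
    lra. }
  assert (Hd2 : 2 * (q + 1) - a0 * t <> 0).
  { intros H; apply (Rlt_irrefl 0); rewrite <- (Rmult_0_l (/ (2 * (q + 1)))), <- H at 2.
    replace ((2 * (q + 1) - a0 * t) * / (2 * (q + 1)))
      with (1 - a0 * t / (2 * (q + 1))) by (field; lra).
    exact Hd. }
  split; apply is_derive_is_derive_nonneg; try exact Ht0;
    (auto_derive; [unfold Rdiv in Hd; lra|field; lra]).
Qed.

(** A solution alive at the pole would turn the product identity into 0 = a. Before the pole it
    coincides with the explicit solution, so stopping earlier would contradict maximality. *)
Lemma CLM_solution_lifespan (q a0 : R) (T : Rbar) (U V : R -> R) :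
  0 < q + 1 -> 0 < a0 -> CLM_solution q a0 0 T U V ->
  T = Finite (2 * (q + 1) / a0).
Proof.
  intros Hq Ha [[[HT0 _] Hmax] HS].
  assert (Hp : 0 < 2 * (q + 1) / a0) by (apply Rdiv_lt_0_compat; lra).
  assert (HT : Rbar_le T (2 * (q + 1) / a0)).
  { apply Rbar_not_lt_le; intros H.
    destruct (CLM_system_zero q a0 T U V (2 * (q + 1) / a0) HS) as [_ E].
    { split; [lra|exact H]. }
    replace (1 - a0 * (2 * (q + 1) / a0) / (2 * (q + 1))) with 0 in E
      by (field; lra).
    lra. }
  symmetry; apply (Hmax _ _ (CLM_problem_riccati q a0 Hq Ha) HT).
  intros t Ht; destruct (CLM_system_zero q a0 T U V t HS Ht) as [_ E].
  assert (1 - a0 * t / (2 * (q + 1)) <> 0) by (intros H; rewrite H in E; lra).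
  rewrite <- E at 1; field; split; [lra|].
  intros H'; apply H; apply (Rmult_eq_reg_r (2 * (q + 1))); [|lra].
  rewrite Rmult_0_l, <- H'; field; lra.
Qed.

Lemma CLM_solution_blowup (q a0 : R) (T : Rbar) (U V : R -> R) :
  0 < q + 1 -> 0 < a0 -> CLM_solution q a0 0 T U V ->
  filterlim V (at_left (2 * (q + 1) / a0)) (Rbar_locally p_infty).
Proof.
  intros Hq Ha HS.
  assert (HT := CLM_solution_lifespan _ _ _ _ _ Hq Ha HS).
  destruct HS as [_ HS]; subst T.
  set (p := 2 * (q + 1) / a0) in *.
  assert (Hp : 0 < p) by (apply Rdiv_lt_0_compat; lra).
  assert (Hd : forall t, 1 - a0 * t / (2 * (q + 1)) = (p - t) / p)
    by (intros t; unfold p; field; lra).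
  intros P [K HK].
  (* In terms of the pole [p] the identity reads V(t) (p - t) = a p, so V(t) > K' as soon as p - t <
     a p / K'. Taking K' >= 1 makes the quotient positive; the bound [p] on the radius keeps t >
     0. *)
  set (K' := Rmax K 1).
  assert (HK' : 0 < K') by (unfold K'; generalize (Rmax_r K 1); lra).
  assert (He : 0 < Rmin p (a0 * p / K')).
  { apply Rmin_case; [exact Hp|apply Rdiv_lt_0_compat; nra]. }
  exists (mkposreal _ He); intros t Hball Hlt; simpl in Hball.
  revert Hball; unfold ball; simpl; unfold AbsRing_ball, abs, minus, plus, opp; simpl.
  intros Hball; apply Rabs_lt_between in Hball.
  generalize (Rmin_l p (a0 * p / K')) (Rmin_r p (a0 * p / K')); intros Hm1 Hm2.
  apply HK, (Rle_lt_trans _ K'); [apply Rmax_l|].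
  destruct (CLM_system_zero q a0 p U V t HS) as [_ E]; [split; simpl; lra|].
  rewrite Hd in E.
  assert (E' : V t * (p - t) = a0 * p) by (rewrite <- E; field; lra).
  apply (Rmult_lt_reg_r (p - t)); [lra|]; rewrite E'.
  replace (a0 * p) with (K' * (a0 * p / K')) by (field; lra).
  apply Rmult_lt_compat_l; lra.
Qed.

(** For a <= 0 the factor multiplying V in the product identity is at least 1. *)
Lemma CLM_system_zero_bounded (q a0 : R) (T : Rbar) (U V : R -> R) (t : R) :
  0 < q + 1 -> a0 <= 0 -> CLM_system q a0 0 T U V -> lifespan T t ->
  Rabs (V t) <= Rabs a0.
Proof.
  intros Hq Ha HS Ht.
  destruct (CLM_system_zero q a0 T U V t HS Ht) as [_ E].
  assert (Hd : 1 <= 1 - a0 * t / (2 * (q + 1))).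
  { destruct Ht as [Ht _].
    assert (0 <= (- a0 * t) / (2 * (q + 1))); [|unfold Rdiv in *; lra].
    apply Rmult_le_pos; [nra|]; apply Rlt_le, Rinv_0_lt_compat; lra. }
  rewrite <- E, Rabs_mult, (Rabs_right (1 - _)) by lra.
  generalize (Rabs_pos (V t)); nra.
Qed.

(** * The blow-up criterion and the blow-up time *)

Theorem theorem2p14 (m : nat) (Hm : m = 1%nat \/ m = 2%nat)
  (q : R) (Hq : q = INR m + 1)
  (a b : R -> R) (T : R -> Rbar) (U V : R -> R -> R)
  (Hsol : forall x, 0 <= x ->
     CLM_solution q (a x) (b x) (T x) (fun t => U t x) (fun t => V t x)) :
  (blows_up_in_finite_time T V <-> exists x, Zset a b x) /\
  (forall xbar M : R,
     Zset a b xbar -> a xbar = M -> (forall x, Zset a b x -> a x <= M) ->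
     T xbar = Finite (2 * (q + 1) / M) /\
     (forall t, lifespan (T xbar) t -> U t xbar = 0) /\
     filterlim (fun t => V t xbar) (at_left (2 * (q + 1) / M))
       (Rbar_locally p_infty)).
Proof.
  assert (Hq1 : 0 < q + 1) by (generalize (pos_INR m); lra).
  assert (Hm1 : (1 <= m)%nat) by lia.
  split; [split|].
  - intros [x [Hx [t0 [Ht0 [HtT Hunb]]]]]; exists x.
    destruct (Hsol x Hx) as [_ HS].
    assert (HL : forall t, 0 <= t < t0 -> lifespan (T x) t).
    { intros t Ht; split; [lra|].
      apply (Rbar_lt_le_trans t t0); [simpl; lra|exact HtT]. }
    (* Blow-up rules out any bound on the whole lifespan, whereas b <> 0, or b = 0 with a <= 0,
       would each supply one. *)
    assert (Hbd : ~ exists K, forall t, lifespan (T x) t -> Rabs (V t x) <= K).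
    { intros [K HK]; destruct (Hunb K) as [t [Ht HVt]].
      specialize (HK t (HL t Ht)); lra. }
    split; [exact Hx|].
    destruct (Req_dec (b x) 0) as [Hb|Hb].
    + split; [exact Hb|].
      destruct (Rlt_le_dec 0 (a x)) as [Ha|Ha]; [exact Ha|].
      rewrite Hb in HS; exfalso; apply Hbd; exists (Rabs (a x)); intros t Ht.
      exact (CLM_system_zero_bounded _ _ _ _ _ t Hq1 Ha HS Ht).
    + exfalso; apply Hbd; subst q.
      exact (CLM_system_bounded m _ _ _ _ _ Hm1 Hb HS).
  - intros [x [Hx [Hb Ha]]]; exists x; split; [exact Hx|].
    generalize (Hsol x Hx); rewrite Hb; intros HS.
    assert (Hp : 0 < 2 * (q + 1) / a x) by (apply Rdiv_lt_0_compat; lra).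
    exists (2 * (q + 1) / a x); split; [exact Hp|split].
    + rewrite (CLM_solution_lifespan _ _ _ _ _ Hq1 Ha HS); apply Rbar_le_refl.
    + intros K.
      (* The limit is tested on the neighbourhood (K, +oo) of +oo; properness of the left filter
         then yields an actual time in (0, p), p being the pole. *)
      assert (HK := CLM_solution_blowup _ _ _ _ _ Hq1 Ha HS (fun y => K < y)
        (ex_intro _ K (fun y Hy => Hy))).
      assert (Hpos : at_left (2 * (q + 1) / a x)
                       (fun t => 0 < t < 2 * (q + 1) / a x)).
      { generalize (open_gt 0 _ Hp); unfold at_left, within.
        apply filter_imp; intros; lra. }
      destruct (filter_ex _ (filter_and _ _ Hpos HK)) as [t [Ht HVt]].
      exists t; split; [lra|]; generalize (Rle_abs (V t x)); lra.
  - intros x M [Hx [Hb Ha]] HM _; subst M.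
    generalize (Hsol x Hx); rewrite Hb; intros HS.
    split; [|split].
    + exact (CLM_solution_lifespan _ _ _ _ _ Hq1 Ha HS).
    + intros t Ht; destruct HS as [_ HS].
      exact (proj1 (CLM_system_zero _ _ _ _ _ t HS Ht)).
    + exact (CLM_solution_blowup _ _ _ _ _ Hq1 Ha HS).
Qed.
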